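(* Suppose $a\geq c>0$ and $\{f_n\}_{n=0}^{\infty}$ is any nonnegative sequence. Let $$f_{a,c}(\mu;x)=\sum_{n=0}^{\infty}f_n\frac{(a+\mu)_n}{(c+\mu)_n}\frac{x^n}{n!},\qquad \phi_{a,c}(\mu,\nu;x)=f_{a,c}(\mu;x)f_{a,c}(\nu;x)-f_{a,c}(0;x)f_{a,c}(\mu+\nu;x).$$ Then the function $\mu\mapsto f_{a,c}(\mu;x)$ is strictly log-convex on $[0,\infty)$ for each fixed $x>0$. Moreover, the family $\{f_{a,c}(\mu;x)\}_{\mu\geq0}$ is Wright $q$-log-convex, i.e. the function $x\mapsto\phi_{a,c}(\mu,\nu;x)$ has non-positive power series coefficients (in powers of $x$) for all $\mu,\nu\ge0$, so that $x\mapsto-\phi_{a,c}(\mu,\nu;x)$ is absolutely monotonic and multiplicatively convex on $(0,\infty)$.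
   Context: $(a)_0=1$, $(a)_n=a(a+1)\cdots(a+n-1)$ is the rising factorial. A function $F:[0,\infty)\to[0,\infty)$ is log-convex if its logarithm is convex, i.e. $F(\lambda\mu+(1-\lambda)\nu)\le F(\mu)^{\lambda}F(\nu)^{1-\lambda}$ for all $\mu,\nu\ge0$, $\lambda\in[0,1]$, and strictly log-convex if the inequality is strict for $\mu\ne\nu$, $\lambda\in(0,1)$. A family $\{f(\mu;x)\}_{\mu\ge0}$ of formal power series in $x$ whose coefficients are nonnegative continuous functions of $\mu$ is Wright $q$-log-convex if $f(\mu+\alpha;x)f(\mu+\beta;x)-f(\mu;x)f(\mu+\alpha+\beta;x)$ has non-positive coefficients at all powers of $x$ for all $\mu,\alpha,\beta\ge0$. A function is absolutely monotonic on an interval if it and all its derivatives are nonnegative there. A nonnegative function $\phi$ is multiplicatively convex if $\phi(x^{\lambda}y^{1-\lambda})\le\phi(x)^{\lambda}\phi(y)^{1-\lambda}$ for all $x,y$ in the interval and $\lambda\in[0,1]$. Power series are understood as formal; assertions about values at fixed $x$, or about functions of $x$ on $(0,\infty)$, are understood for those $x>0$ in the interval of convergence of the series.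
   Formalization: Strict log-convexity is asserted only when a>c and f_n>0 for some n≥1; otherwise f_{a,c}(μ;x) is constant in μ and only log-convexity, stated for all a≥c>0, can hold. *)

(* Defs.v *)
From Stdlib Require Import Reals Factorial.
From Coquelicot Require Import Coquelicot.
Open Scope R_scope.

Fixpoint rising (a : R) (n : nat) : R :=
  match n with
  | O => 1
  | S k => rising a k * (a + INR k)
  end.

(* Real power of a nonnegative base, with 0^0 = 1 and 0^t = 0 for t <> 0.
   [Rpower] alone is unsuitable here, since [Rpower 0 t = 1] for all t. *)
Definition rpow (b t : R) : R :=
  if Req_EM_T b 0 then (if Req_EM_T t 0 then 1 else 0) else Rpower b t.

(* A function [0,oo) -> [0,oo) is encoded by a total function on R, of which
   only the values on [0,oo) matter. *)
Definition log_convex (F : R -> R) : Prop :=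
  (forall mu, 0 <= mu -> 0 <= F mu) /\
  (forall mu nu lambda, 0 <= mu -> 0 <= nu -> 0 <= lambda <= 1 ->
     F (lambda * mu + (1 - lambda) * nu)
       <= rpow (F mu) lambda * rpow (F nu) (1 - lambda)).

Definition strictly_log_convex (F : R -> R) : Prop :=
  log_convex F /\
  (forall mu nu lambda, 0 <= mu -> 0 <= nu -> mu <> nu -> 0 < lambda < 1 ->
     F (lambda * mu + (1 - lambda) * nu)
       < rpow (F mu) lambda * rpow (F nu) (1 - lambda)).

(* A formal power series is its coefficient sequence; [g mu n] is the
   coefficient of x^n in the series of index mu, for mu >= 0. *)
Definition wright_q_log_convex (g : R -> nat -> R) : Prop :=
  (forall n mu, 0 <= mu -> 0 <= g mu n) /\
  (forall n, continuous_on (fun mu => 0 <= mu) (fun mu => g mu n)) /\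
  (forall mu alpha beta, 0 <= mu -> 0 <= alpha -> 0 <= beta ->
     forall n,
       PS_minus (PS_mult (g (mu + alpha)) (g (mu + beta)))
                (PS_mult (g mu) (g (mu + alpha + beta))) n <= 0).

(* Derivatives are two-sided, so they are only considered at interior points of
   the interval [I]; at an endpoint belonging to [I] a power series need not be
   differentiable. *)
Definition absolutely_monotonic_on (I : R -> Prop) (h : R -> R) : Prop :=
  (forall x, I x -> 0 <= h x) /\
  (forall n x, locally x I -> ex_derive_n h n x /\ 0 <= Derive_n h n x).

(* [I] is meant to be an interval contained in (0,oo). *)
Definition multiplicatively_convex_on (I : R -> Prop) (h : R -> R) : Prop :=
  (forall x, I x -> 0 <= h x) /\
  (forall x y lambda, I x -> I y -> 0 <= lambda <= 1 ->
     h (rpow x lambda * rpow y (1 - lambda))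
       <= rpow (h x) lambda * rpow (h y) (1 - lambda)).

Section Family.

Variables (f : nat -> R) (a c : R).

Definition fser (mu : R) (n : nat) : R :=
  f n * (rising (a + mu) n / rising (c + mu) n) / INR (fact n).

Definition fval (mu x : R) : R := PSeries (fser mu) x.

Definition phiser (mu nu : R) : nat -> R :=
  PS_minus (PS_mult (fser mu) (fser nu)) (PS_mult (fser 0) (fser (mu + nu))).

Definition phival (mu nu x : R) : R :=
  fval mu x * fval nu x - fval 0 x * fval (mu + nu) x.

(* The positive part of the interval of convergence. For a, c > 0, convergence
   at x > 0 does not depend on mu, because the quotient of the coefficients
   for two values of mu tends to a positive limit (wherever f n <> 0). *)
Definition conv_interval (x : R) : Prop :=
  0 < x /\ forall mu, 0 <= mu -> ex_pseries (fser mu) x.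

End Family.

(* Main.v *)
Require Import Defs.
From Stdlib Require Import Reals Factorial Lra Lia Classical.
From Coquelicot Require Import Coquelicot.
Open Scope R_scope.

(** Everything rests on the single factor [h t = (a + t) / (c + t)], which is
    [1 + (a - c) / (c + t)].  For [a >= c > 0] it is positive, nonincreasing, and
    log-convex: the constant [1] is log-convex, [t |-> 1 / (c + t)] is
    log-convex by the weighted arithmetic-geometric mean inequality, and sums
    of log-convex functions are log-convex by Hölder's inequality.  The
    quotient of rising factorials [rratio a c n t] is a product of such factors
    with shifted [a] and [c], so it is nonincreasing and log-convex too; the series
    is a nonnegative combination of these quotients, and Hölder's inequality for
    series ([holder_series]) gives its log-convexity.  Strictness in one term
    with positive weight makes the whole inequality strict.

    For the Cauchy products, the coefficient of [x^n] in
    [f(mu+alpha) f(mu+beta) - f(mu) f(mu+alpha+beta)] does not have a sign term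
    by term; it is the sum of the terms of index [k] and [n - k] that does.
    For [k <= m = n - k], write the quotient of length [m] as the one of length
    [k], say [u], times the quotient [s] for [a + k], [c + k].  The pair then
    contributes
      [u(mu+alpha) u(mu+beta) (s(mu+alpha) + s(mu+beta))
         - u(mu) u(mu+alpha+beta) (s(mu) + s(mu+alpha+beta))],
    which is nonpositive because [u] is multiplicatively Wright-convex
    ([rratio_wright]) and [s], being nonincreasing as well, is also additively
    Wright-convex ([rratio_wright_sum]).

    So [- phi] is a power series with nonnegative coefficients on the interval
    of convergence.  Its derivatives inside the interval are again such series,
    and its multiplicative convexity is Hölder's inequality once more, applied
    to the monomials, for which
    [(x^lambda y^(1-lambda))^n = (x^n)^lambda (y^n)^(1-lambda)]. *)

(** * Weighted geometric means *)

Definition wgm (l u v : R) : R := Rpower u l * Rpower v (1 - l).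

Lemma wgm_pos l u v : 0 < wgm l u v.
Proof. apply Rmult_lt_0_compat; apply exp_pos. Qed.

Lemma wgm_exp l u v : wgm l u v = exp (l * ln u + (1 - l) * ln v).
Proof. unfold wgm, Rpower. now rewrite <- exp_plus. Qed.

Lemma wgm_mult l u u' v v' : 0 < u -> 0 < u' -> 0 < v -> 0 < v' ->
  wgm l (u * u') (v * v') = wgm l u v * wgm l u' v'.
Proof.
  intros. unfold wgm. rewrite <- !Rpower_mult_distr by assumption. ring.
Qed.

Lemma wgm_diag l u : 0 < u -> wgm l u u = u.
Proof.
  intros Hu. rewrite wgm_exp. replace (l * ln u + (1 - l) * ln u) with (ln u) by ring.
  now apply exp_ln.
Qed.

Lemma wgm_pow l u v n : 0 < u -> 0 < v ->
  wgm l (u ^ n) (v ^ n) = wgm l u v ^ n.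
Proof.
  intros Hu Hv. induction n as [|n IH]; simpl.
  - apply wgm_diag, Rlt_0_1.
  - rewrite wgm_mult, IH; auto using pow_lt.
Qed.

Lemma wgm_inv l u v : 0 < u -> 0 < v -> wgm l (/ u) (/ v) = / wgm l u v.
Proof.
  intros Hu Hv. rewrite !wgm_exp, !ln_Rinv by assumption.
  rewrite <- exp_Ropp. f_equal. ring.
Qed.

Lemma rpow_wgm l u v : 0 < u -> 0 < v -> rpow u l * rpow v (1 - l) = wgm l u v.
Proof.
  intros Hu Hv. unfold rpow, wgm.
  destruct (Req_EM_T u 0); [lra|]. destruct (Req_EM_T v 0); [lra|]. reflexivity.
Qed.

Lemma rpow_nonneg u l : 0 <= rpow u l.
Proof.
  unfold rpow. destruct (Req_EM_T u 0).
  - destruct (Req_EM_T l 0); lra.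
  - left; apply exp_pos.
Qed.

Lemma exp_ge_1_plus x : 1 + x <= exp x.
Proof.
  destruct (Req_dec x 0) as [->|H].
  - rewrite exp_0; lra.
  - left; now apply exp_ineq1.
Qed.

(** With [g] the logarithm of the mean, [u] is [e^g e^(ln u - g)], hence at least
    [e^g (1 + ln u - g)], and the weighted sum of the two corrections
    [ln u - g] and [ln v - g] is zero. *)
Lemma young l u v : 0 <= l <= 1 -> 0 < u -> 0 < v ->
  wgm l u v <= l * u + (1 - l) * v.
Proof.
  intros Hl Hu Hv. rewrite wgm_exp. set (g := l * ln u + (1 - l) * ln v).
  assert (Eu : u = exp g * exp (ln u - g)).
  { rewrite <- exp_plus. replace (g + (ln u - g)) with (ln u) by ring.
    now rewrite exp_ln. }
  assert (Ev : v = exp g * exp (ln v - g)).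
  { rewrite <- exp_plus. replace (g + (ln v - g)) with (ln v) by ring.
    now rewrite exp_ln. }
  pose proof (exp_pos g) as Hg.
  pose proof (exp_ge_1_plus (ln u - g)) as Hu1.
  pose proof (exp_ge_1_plus (ln v - g)) as Hv1.
  assert (H : 1 <= l * exp (ln u - g) + (1 - l) * exp (ln v - g)).
  { replace 1 with (l * (1 + (ln u - g)) + (1 - l) * (1 + (ln v - g))) at 1
      by (unfold g; ring).
    apply Rplus_le_compat; apply Rmult_le_compat_l; lra. }
  rewrite Eu at 1. rewrite Ev at 1.
  apply Rle_trans with (exp g * 1); [lra|].
  apply Rle_trans with (exp g * (l * exp (ln u - g) + (1 - l) * exp (ln v - g))).
  - apply Rmult_le_compat_l; lra.
  - right; ring.
Qed.

Lemma young_strict l u v : 0 < l < 1 -> 0 < u -> 0 < v -> u <> v ->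
  wgm l u v < l * u + (1 - l) * v.
Proof.
  intros Hl Hu Hv Huv. rewrite wgm_exp. set (g := l * ln u + (1 - l) * ln v).
  assert (Eu : u = exp g * exp (ln u - g)).
  { rewrite <- exp_plus. replace (g + (ln u - g)) with (ln u) by ring.
    now rewrite exp_ln. }
  assert (Ev : v = exp g * exp (ln v - g)).
  { rewrite <- exp_plus. replace (g + (ln v - g)) with (ln v) by ring.
    now rewrite exp_ln. }
  pose proof (exp_pos g) as Hg.
  assert (Hu1 : 1 + (ln u - g) < exp (ln u - g)).
  { apply exp_ineq1. unfold g. intros E. apply Huv, ln_inv; try assumption.
    assert (E' : (1 - l) * (ln u - ln v) = 0) by lra.
    apply Rmult_integral in E'. lra. }
  pose proof (exp_ge_1_plus (ln v - g)) as Hv1.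
  assert (H : 1 < l * exp (ln u - g) + (1 - l) * exp (ln v - g)).
  { replace 1 with (l * (1 + (ln u - g)) + (1 - l) * (1 + (ln v - g))) at 1
      by (unfold g; ring).
    apply Rplus_lt_le_compat.
    - apply Rmult_lt_compat_l; lra.
    - apply Rmult_le_compat_l; lra. }
  rewrite Eu at 1. rewrite Ev at 1.
  apply Rle_lt_trans with (exp g * 1); [lra|].
  apply Rlt_le_trans with (exp g * (l * exp (ln u - g) + (1 - l) * exp (ln v - g))).
  - apply Rmult_lt_compat_l; lra.
  - right; ring.
Qed.

(** Normalising by [U] and [V] makes the bound linear in [u] and [v], so that it
    can be summed; when [u] and [v] add up to [U] and [V], the bounds add up to
    the mean of [U] and [V].  This is the mechanism of Hölder's inequality. *)
Lemma young_scaled l u v U V : 0 <= l <= 1 ->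
  0 < u -> 0 < v -> 0 < U -> 0 < V ->
  wgm l u v <= wgm l U V * (l * (u / U) + (1 - l) * (v / V)).
Proof.
  intros Hl Hu Hv HU HV.
  assert (Hu' : 0 < u / U) by now apply Rdiv_lt_0_compat.
  assert (Hv' : 0 < v / V) by now apply Rdiv_lt_0_compat.
  replace (wgm l u v) with (wgm l U V * wgm l (u / U) (v / V)).
  - apply Rmult_le_compat_l; [left; apply wgm_pos | now apply young].
  - rewrite <- wgm_mult by assumption. f_equal; field; lra.
Qed.

(** * Series with nonnegative terms *)

Lemma ex_series_Rmult (r : R) (t : nat -> R) :
  ex_series t -> ex_series (fun n => r * t n).
Proof. exact (ex_series_scal (V := R_NormedModule) r t). Qed.

Lemma Series_nonneg (t : nat -> R) :
  (forall n, 0 <= t n) -> ex_series t -> 0 <= Series t.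
Proof.
  intros Ht He. rewrite <- (Rmult_0_l (Series t)), <- Series_scal_l.
  apply Series_le; [|assumption]. intros n. specialize (Ht n). lra.
Qed.

Lemma Series_ge_term (t : nat -> R) n :
  (forall k, 0 <= t k) -> ex_series t -> t n <= Series t.
Proof.
  revert t. induction n as [|n IH]; intros t Ht He;
    rewrite (Series_incr_1 t He);
    assert (He' : ex_series (fun k => t (S k))) by now apply ex_series_incr_1 in He.
  - pose proof (Series_nonneg (fun k => t (S k)) (fun k => Ht (S k)) He'). lra.
  - pose proof (IH (fun k => t (S k)) (fun k => Ht (S k)) He').
    specialize (Ht O). simpl in *. lra.
Qed.

Lemma ex_series_dominated (s b : nat -> R) :
  (forall n, 0 <= s n <= b n) -> ex_series b -> ex_series s.
Proof.
  intros H Hb. apply (ex_series_le s b); [|assumption].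
  intros n. change (Rabs (s n) <= b n). rewrite Rabs_pos_eq; apply H.
Qed.

Lemma Series_lt_of_term (s b : nat -> R) n :
  (forall k, 0 <= s k <= b k) -> ex_series b -> s n < b n -> Series s < Series b.
Proof.
  intros H Hb Hn.
  assert (Hs : ex_series s) by now apply ex_series_dominated with b.
  assert (Hd : ex_series (fun k => b k - s k)).
  { apply (ex_series_minus (V := R_NormedModule) b s); assumption. }
  pose proof (Series_ge_term (fun k => b k - s k) n) as G. cbv beta in G.
  rewrite Series_minus in G by assumption.
  assert (b n - s n <= Series b - Series s); [|lra].
  apply G; [|assumption]. intros k. specialize (H k). lra.
Qed.

Section Holder.

Variables (l : R) (w s u v : nat -> R).
Hypothesis Hl : 0 <= l <= 1.
Hypothesis Hw : forall n, 0 <= w n.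
Hypothesis Hu : forall n, 0 < u n.
Hypothesis Hv : forall n, 0 < v n.
Hypothesis Hs : forall n, 0 <= s n <= wgm l (u n) (v n).
Hypothesis Eu : ex_series (fun n => w n * u n).
Hypothesis Ev : ex_series (fun n => w n * v n).

Let U := Series (fun n => w n * u n).
Let V := Series (fun n => w n * v n).

(** Summand of the linearised bound given by [young_scaled]. *)
Let b n := wgm l U V * (l / U) * (w n * u n)
           + wgm l U V * ((1 - l) / V) * (w n * v n).

Lemma weighted_series_pos (t : nat -> R) n :
  (forall k, 0 < t k) -> ex_series (fun k => w k * t k) ->
  0 < w n -> 0 < Series (fun k => w k * t k).
Proof.
  intros Ht Et Hn. apply Rlt_le_trans with (w n * t n).
  - now apply Rmult_lt_0_compat.
  - apply (Series_ge_term (fun k => w k * t k)); [|assumption].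
    intros k. apply Rmult_le_pos; [apply Hw | left; apply Ht].
Qed.

Lemma ex_series_holder_bound : ex_series b.
Proof.
  apply (ex_series_plus (V := R_NormedModule)
    (fun n => wgm l U V * (l / U) * (w n * u n))
    (fun n => wgm l U V * ((1 - l) / V) * (w n * v n)));
    now apply ex_series_Rmult.
Qed.

Lemma Series_holder_bound : 0 < U -> 0 < V -> Series b = wgm l U V.
Proof.
  intros HU HV. unfold b. rewrite Series_plus, !Series_scal_l.
  - fold U V. field. lra.
  - now apply ex_series_Rmult.
  - now apply ex_series_Rmult.
Qed.

Lemma wgm_le_holder_bound n : 0 < U -> 0 < V -> w n * wgm l (u n) (v n) <= b n.
Proof.
  intros HU HV.
  pose proof (young_scaled l (u n) (v n) U V Hl (Hu n) (Hv n) HU HV) as Y.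
  apply (Rmult_le_compat_l (w n)) in Y; [|apply Hw].
  eapply Rle_trans; [apply Y|]. right. unfold b. field. lra.
Qed.

Lemma holder_term n : 0 < U -> 0 < V -> 0 <= w n * s n <= b n.
Proof.
  intros HU HV. split; [apply Rmult_le_pos; [apply Hw | apply Hs]|].
  eapply Rle_trans; [|now apply wgm_le_holder_bound].
  apply Rmult_le_compat_l; [apply Hw | apply Hs].
Qed.

Lemma holder_series : Series (fun n => w n * s n) <= rpow U l * rpow V (1 - l).
Proof.
  destruct (classic (exists n, 0 < w n)) as [[n Hn]|H0].
  - assert (HU : 0 < U) by now apply weighted_series_pos with n.
    assert (HV : 0 < V) by now apply weighted_series_pos with n.
    rewrite rpow_wgm, <- Series_holder_bound by assumption.
    apply Series_le; [|apply ex_series_holder_bound].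
    intros k. now apply holder_term.
  - rewrite (Series_ext _ (fun n => 0 * s n)).
    + rewrite Series_scal_l, Rmult_0_l. apply Rmult_le_pos; apply rpow_nonneg.
    + intros n. f_equal. apply Rle_antisym; [|apply Hw].
      apply Rnot_lt_le. intros Hn. apply H0. now exists n.
Qed.

Lemma holder_series_strict n : 0 < w n -> s n < wgm l (u n) (v n) ->
  Series (fun n => w n * s n) < rpow U l * rpow V (1 - l).
Proof.
  intros Hn Hlt.
  assert (HU : 0 < U) by now apply weighted_series_pos with n.
  assert (HV : 0 < V) by now apply weighted_series_pos with n.
  rewrite rpow_wgm, <- Series_holder_bound by assumption.
  apply Series_lt_of_term with n.
  - intros k. now apply holder_term.
  - apply ex_series_holder_bound.
  - eapply Rlt_le_trans; [|now apply wgm_le_holder_bound].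
    now apply Rmult_lt_compat_l.
Qed.

End Holder.

(** * The factor (a + t) / (c + t) *)

(** Hölder's inequality for the two summands of [1 + (a - c) / (c + t)]; the
    second summand is log-convex because the geometric mean of [c + mu] and
    [c + nu] is at most their arithmetic mean. *)
Lemma factor_log_convex a c mu nu l : 0 < c <= a -> 0 <= mu -> 0 <= nu ->
  0 <= l <= 1 ->
  let m := l * mu + (1 - l) * nu in
  (a + m) / (c + m) <= wgm l ((a + mu) / (c + mu)) ((a + nu) / (c + nu)) /\
  (c < a -> mu <> nu -> 0 < l < 1 ->
   (a + m) / (c + m) < wgm l ((a + mu) / (c + mu)) ((a + nu) / (c + nu))).
Proof.
  intros Hac Hmu Hnu Hl m.
  assert (Hm : 0 <= m) by (apply Rplus_le_le_0_compat; apply Rmult_le_pos; lra).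
  set (U := (a + mu) / (c + mu)). set (V := (a + nu) / (c + nu)).
  assert (HU : 0 < U) by (apply Rdiv_lt_0_compat; lra).
  assert (HV : 0 < V) by (apply Rdiv_lt_0_compat; lra).
  pose proof (young_scaled l 1 1 U V Hl Rlt_0_1 Rlt_0_1 HU HV) as Y1.
  rewrite wgm_diag in Y1 by lra.
  assert (Hp : 0 < / (c + mu)) by (apply Rinv_0_lt_compat; lra).
  assert (Hq : 0 < / (c + nu)) by (apply Rinv_0_lt_compat; lra).
  pose proof (young_scaled l _ _ U V Hl Hp Hq HU HV) as Y2.
  rewrite wgm_inv in Y2 by lra.
  set (g := wgm l (c + mu) (c + nu)) in *.
  assert (Hg : 0 < g) by apply wgm_pos.
  assert (Egm : c + m = l * (c + mu) + (1 - l) * (c + nu)) by (unfold m; ring).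
  assert (E1 : (a + m) / (c + m) = 1 + (a - c) * / (c + m)) by (field; lra).
  set (K := wgm l U V) in *.
  assert (E2 : K = K * (l * (1 / U) + (1 - l) * (1 / V))
                 + (a - c) * (K * (l * (/ (c + mu) / U) + (1 - l) * (/ (c + nu) / V)))).
  { unfold U, V. field. lra. }
  apply (Rmult_le_compat_l (a - c)) in Y2; [|lra].
  rewrite E1. split.
  - assert (G : g <= c + m) by (rewrite Egm; apply young; lra).
    apply (Rinv_le_contravar g _ Hg) in G.
    apply (Rmult_le_compat_l (a - c)) in G; lra.
  - intros Hlt Hne Hl'.
    assert (G : g < c + m) by (rewrite Egm; apply young_strict; lra).
    apply Rinv_lt_contravar in G; [|apply Rmult_lt_0_compat; lra].
    apply (Rmult_lt_compat_l (a - c)) in G; lra.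
Qed.

Lemma factor_wright a c t alpha beta : 0 < c <= a -> 0 <= t ->
  0 <= alpha -> 0 <= beta ->
  (a + (t + alpha)) / (c + (t + alpha)) * ((a + (t + beta)) / (c + (t + beta)))
  <= (a + t) / (c + t) * ((a + (t + alpha + beta)) / (c + (t + alpha + beta))).
Proof.
  intros Hac Ht Ha Hb.
  (* The two numerators, like the two denominators, differ by [alpha * beta]. *)
  set (P := (c + t) * (c + (t + alpha + beta))).
  set (Q := (a + t) * (a + (t + alpha + beta))).
  assert (HP : 0 < P) by (apply Rmult_lt_0_compat; lra).
  assert (HPQ : P <= Q) by (apply Rmult_le_compat; lra).
  assert (Hab : 0 <= alpha * beta) by now apply Rmult_le_pos.
  assert (E1 : (a + (t + alpha)) / (c + (t + alpha))
                 * ((a + (t + beta)) / (c + (t + beta)))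
               = (Q + alpha * beta) / (P + alpha * beta)).
  { unfold P, Q. field. repeat split; try lra. fold P. lra. }
  assert (E2 : (a + t) / (c + t)
                 * ((a + (t + alpha + beta)) / (c + (t + alpha + beta))) = Q / P).
  { unfold P, Q. field. lra. }
  rewrite E1, E2.
  apply Rmult_le_reg_r with (P * (P + alpha * beta)).
  { apply Rmult_lt_0_compat; lra. }
  replace ((Q + alpha * beta) / (P + alpha * beta) * (P * (P + alpha * beta)))
    with ((Q + alpha * beta) * P) by (field; lra).
  replace (Q / P * (P * (P + alpha * beta))) with (Q * (P + alpha * beta))
    by (field; lra).
  apply (Rmult_le_compat_l (alpha * beta)) in HPQ; lra.
Qed.

Lemma factor_antitone a c s t : 0 < c <= a -> 0 <= s <= t ->
  (a + t) / (c + t) <= (a + s) / (c + s).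
Proof.
  intros Hac Hst.
  replace ((a + t) / (c + t)) with (1 + (a - c) * / (c + t)) by (field; lra).
  replace ((a + s) / (c + s)) with (1 + (a - c) * / (c + s)) by (field; lra).
  apply Rplus_le_compat_l, Rmult_le_compat_l; [lra|].
  apply Rinv_le_contravar; lra.
Qed.

(** * Quotients of rising factorials *)

Definition rratio (a c : R) (n : nat) (t : R) : R :=
  rising (a + t) n / rising (c + t) n.

Lemma rising_pos a n : 0 < a -> 0 < rising a n.
Proof.
  intros Ha. induction n as [|n IH]; simpl; [lra|].
  apply Rmult_lt_0_compat; [assumption|]. pose proof (pos_INR n); lra.
Qed.

Lemma rising_add a k j : rising a (k + j) = rising a k * rising (a + INR k) j.
Proof.
  induction j as [|j IH]; simpl.
  - rewrite Nat.add_0_r; ring.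
  - rewrite Nat.add_succ_r; simpl. rewrite IH, plus_INR. ring.
Qed.

Lemma rratio_pos a c n t : 0 < c <= a -> 0 <= t -> 0 < rratio a c n t.
Proof.
  intros Hac Ht. apply Rdiv_lt_0_compat; apply rising_pos; lra.
Qed.

Lemma rratio_0 a c t : rratio a c 0 t = 1.
Proof. unfold rratio; simpl; field. Qed.

Lemma rratio_S a c n t : 0 < c <= a -> 0 <= t ->
  rratio a c (S n) t
  = rratio a c n t * ((a + INR n + t) / (c + INR n + t)).
Proof.
  intros Hac Ht. unfold rratio; simpl.
  pose proof (rising_pos (c + t) n ltac:(lra)). pose proof (pos_INR n).
  field. lra.
Qed.

Lemma rratio_add a c k j t : 0 < c <= a -> 0 <= t ->
  rratio a c (k + j) t = rratio a c k t * rratio (a + INR k) (c + INR k) j t.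
Proof.
  intros Hac Ht. unfold rratio. rewrite !rising_add.
  replace (a + t + INR k) with (a + INR k + t) by ring.
  replace (c + t + INR k) with (c + INR k + t) by ring.
  pose proof (pos_INR k).
  pose proof (rising_pos (c + t) k ltac:(lra)).
  pose proof (rising_pos (c + INR k + t) j ltac:(lra)).
  field. lra.
Qed.

Lemma rratio_antitone a c n s t : 0 < c <= a -> 0 <= s <= t ->
  rratio a c n t <= rratio a c n s.
Proof.
  intros Hac Hst. induction n as [|n IH].
  - rewrite !rratio_0; lra.
  - rewrite !rratio_S by lra. pose proof (pos_INR n). apply Rmult_le_compat.
    + left; apply rratio_pos; lra.
    + left; apply Rdiv_lt_0_compat; lra.
    + assumption.
    + apply factor_antitone; lra.
Qed.

Lemma rratio_log_convex a c n mu nu l : 0 < c <= a -> 0 <= mu -> 0 <= nu ->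
  0 <= l <= 1 ->
  rratio a c n (l * mu + (1 - l) * nu)
  <= wgm l (rratio a c n mu) (rratio a c n nu).
Proof.
  intros Hac Hmu Hnu Hl. set (m := l * mu + (1 - l) * nu).
  assert (Hm : 0 <= m) by (apply Rplus_le_le_0_compat; apply Rmult_le_pos; lra).
  induction n as [|n IH].
  - rewrite !rratio_0, wgm_diag; lra.
  - pose proof (pos_INR n). rewrite !rratio_S by lra.
    rewrite wgm_mult;
      try (apply rratio_pos; lra); try (apply Rdiv_lt_0_compat; lra).
    apply Rmult_le_compat; [left; apply rratio_pos; lra| | assumption|].
    + left; apply Rdiv_lt_0_compat; lra.
    + apply factor_log_convex; lra.
Qed.

Lemma rratio_log_convex_strict a c n mu nu l : 0 < c < a -> 0 <= mu -> 0 <= nu ->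
  mu <> nu -> 0 < l < 1 -> (1 <= n)%nat ->
  rratio a c n (l * mu + (1 - l) * nu)
  < wgm l (rratio a c n mu) (rratio a c n nu).
Proof.
  intros Hac Hmu Hnu Hne Hl Hn. destruct n as [|n]; [lia|].
  set (m := l * mu + (1 - l) * nu).
  assert (Hm : 0 <= m) by (apply Rplus_le_le_0_compat; apply Rmult_le_pos; lra).
  pose proof (pos_INR n). rewrite !rratio_S by lra.
  rewrite wgm_mult;
    try (apply rratio_pos; lra); try (apply Rdiv_lt_0_compat; lra).
  apply Rle_lt_trans with (wgm l (rratio a c n mu) (rratio a c n nu)
                           * ((a + INR n + m) / (c + INR n + m))).
  - apply Rmult_le_compat_r; [left; apply Rdiv_lt_0_compat; lra|].
    apply rratio_log_convex; lra.
  - apply Rmult_lt_compat_l; [apply wgm_pos|].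
    apply factor_log_convex; lra.
Qed.

Lemma rratio_wright a c n t alpha beta : 0 < c <= a -> 0 <= t ->
  0 <= alpha -> 0 <= beta ->
  rratio a c n (t + alpha) * rratio a c n (t + beta)
  <= rratio a c n t * rratio a c n (t + alpha + beta).
Proof.
  intros Hac Ht Ha Hb. induction n as [|n IH].
  - rewrite !rratio_0; lra.
  - rewrite !rratio_S by lra. pose proof (pos_INR n).
    pose proof (factor_wright (a + INR n) (c + INR n) t alpha beta
                  ltac:(lra) Ht Ha Hb) as F.
    match goal with |- ?r1 * ?h1 * (?r2 * ?h2) <= ?r3 * ?h3 * (?r4 * ?h4) =>
      replace (r1 * h1 * (r2 * h2)) with ((r1 * r2) * (h1 * h2)) by ring;
      replace (r3 * h3 * (r4 * h4)) with ((r3 * r4) * (h3 * h4)) by ring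
    end.
    apply Rmult_le_compat; try assumption.
    + apply Rmult_le_pos; left; apply rratio_pos; lra.
    + apply Rmult_le_pos; left; apply Rdiv_lt_0_compat; lra.
Qed.

(** For [p] at least [x] and [y], the product [(p - x) (p - y)] is nonnegative;
    expanding it and using [x y <= p q] gives [x + y <= p + q]. *)
Lemma sum_le_of_prod_le p q x y : 0 < p -> x <= p -> y <= p -> x * y <= p * q ->
  x + y <= p + q.
Proof.
  intros Hp Hx Hy H. apply Rmult_le_reg_l with p; [assumption|].
  assert (0 <= (p - x) * (p - y)) by (apply Rmult_le_pos; lra). lra.
Qed.

Lemma rratio_wright_sum a c n t alpha beta : 0 < c <= a -> 0 <= t ->
  0 <= alpha -> 0 <= beta ->
  rratio a c n (t + alpha) + rratio a c n (t + beta)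
  <= rratio a c n t + rratio a c n (t + alpha + beta).
Proof.
  intros Hac Ht Ha Hb. apply sum_le_of_prod_le.
  - apply rratio_pos; lra.
  - apply rratio_antitone; lra.
  - apply rratio_antitone; lra.
  - now apply rratio_wright.
Qed.

(** Factoring the shorter quotient out of the longer one reduces the symmetrised
    inequality to the product of the multiplicative inequality for the shorter
    quotient and the additive one for the cofactor. *)
Lemma rratio_wright_pair_le a c k m t alpha beta : 0 < c <= a -> 0 <= t ->
  0 <= alpha -> 0 <= beta -> (k <= m)%nat ->
  rratio a c k (t + alpha) * rratio a c m (t + beta)
  + rratio a c m (t + alpha) * rratio a c k (t + beta)
  <= rratio a c k t * rratio a c m (t + alpha + beta)
     + rratio a c m t * rratio a c k (t + alpha + beta).
Proof.
  intros Hac Ht Ha Hb Hkm. replace m with (k + (m - k))%nat by lia.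
  rewrite !(rratio_add a c k (m - k)) by lra. pose proof (pos_INR k).
  pose proof (rratio_wright a c k t alpha beta Hac Ht Ha Hb) as M.
  pose proof (rratio_wright_sum (a + INR k) (c + INR k) (m - k) t alpha beta
                ltac:(lra) Ht Ha Hb) as A.
  match type of M with ?r1 * ?r2 <= ?r3 * ?r4 =>
    match type of A with ?s1 + ?s2 <= ?s3 + ?s4 =>
      replace (r1 * (r2 * s2) + r1 * s1 * r2) with ((r1 * r2) * (s1 + s2)) by ring;
      replace (r3 * (r4 * s4) + r3 * s3 * r4) with ((r3 * r4) * (s3 + s4)) by ring
    end
  end.
  apply Rmult_le_compat; try assumption.
  - apply Rmult_le_pos; left; apply rratio_pos; lra.
  - apply Rplus_le_le_0_compat; left; apply rratio_pos; lra.
Qed.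

Lemma rratio_wright_pair a c k m t alpha beta : 0 < c <= a -> 0 <= t ->
  0 <= alpha -> 0 <= beta ->
  rratio a c k (t + alpha) * rratio a c m (t + beta)
  + rratio a c m (t + alpha) * rratio a c k (t + beta)
  <= rratio a c k t * rratio a c m (t + alpha + beta)
     + rratio a c m t * rratio a c k (t + alpha + beta).
Proof.
  intros Hac Ht Ha Hb. destruct (Nat.le_ge_cases k m) as [H|H].
  - now apply rratio_wright_pair_le.
  - pose proof (rratio_wright_pair_le a c m k t alpha beta Hac Ht Ha Hb H). lra.
Qed.

Lemma ex_derive_rising n a t : ex_derive (fun s => rising (a + s) n) t.
Proof.
  induction n as [|n IH]; simpl.
  - apply ex_derive_const.
  - apply @ex_derive_mult; [assumption|]. auto_derive. exact I.
Qed.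

Lemma continuous_rratio a c n t : 0 < c -> 0 <= t ->
  continuous (rratio a c n) t.
Proof.
  intros Hc Ht. apply (ex_derive_continuous (rratio a c n)).
  apply ex_derive_div; try apply ex_derive_rising.
  apply Rgt_not_eq, rising_pos; lra.
Qed.

(** * The family of series *)

(** A sum whose terms are not signed can be signed after pairing each term with
    its mirror image. *)
Lemma sum_le_0_of_pairs (A : nat -> R) n :
  (forall k, (k <= n)%nat -> A k + A (n - k)%nat <= 0) -> sum_f_R0 A n <= 0.
Proof.
  intros H.
  assert (E : sum_f_R0 A n + sum_f_R0 A n
              = sum_f_R0 (fun k => A k + A (n - k)%nat) n).
  { rewrite sum_plus, (sum_f_R0_skip A). reflexivity. }
  pose proof (sum_Rle _ (fun _ => 0) n H) as S. rewrite sum_cte in S. lra.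
Qed.

Section Family.

Variables (f : nat -> R) (a c : R).
Hypothesis Hac : 0 < c <= a.
Hypothesis Hf : forall n, 0 <= f n.

Let weight n := f n / INR (fact n).

Lemma weight_nonneg n : 0 <= weight n.
Proof.
  apply Rmult_le_pos; [apply Hf | left; apply Rinv_0_lt_compat, INR_fact_lt_0].
Qed.

Lemma fser_rratio mu n : fser f a c mu n = weight n * rratio a c n mu.
Proof. unfold fser, weight, rratio, Rdiv. ring. Qed.

Lemma fser_pow mu x n :
  fser f a c mu n * x ^ n = weight n * x ^ n * rratio a c n mu.
Proof. rewrite fser_rratio. ring. Qed.

Lemma fser_nonneg mu n : 0 <= mu -> 0 <= fser f a c mu n.
Proof.
  intros Hmu. rewrite fser_rratio.
  apply Rmult_le_pos; [apply weight_nonneg | left; apply rratio_pos; lra].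
Qed.

Lemma fser_continuous n :
  continuous_on (fun mu => 0 <= mu) (fun mu => fser f a c mu n).
Proof.
  apply continuous_on_forall. intros mu Hmu.
  apply (continuous_ext (fun t => weight n * rratio a c n t)).
  { intros t. symmetry. apply fser_rratio. }
  apply (continuous_scal_r (V := R_NormedModule) (weight n) (rratio a c n)).
  apply continuous_rratio; lra.
Qed.

Lemma fser_wright mu alpha beta n : 0 <= mu -> 0 <= alpha -> 0 <= beta ->
  PS_minus (PS_mult (fser f a c (mu + alpha)) (fser f a c (mu + beta)))
           (PS_mult (fser f a c mu) (fser f a c (mu + alpha + beta))) n <= 0.
Proof.
  intros Hmu Ha Hb. unfold PS_minus, PS_mult, plus, opp; simpl.
  rewrite <- Rminus_def, <- minus_sum. apply sum_le_0_of_pairs.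
  intros k Hk. replace (n - (n - k))%nat with k by lia.
  rewrite !fser_rratio. set (m := (n - k)%nat).
  pose proof (rratio_wright_pair a c k m mu alpha beta Hac Hmu Ha Hb) as P.
  apply (Rmult_le_compat_l (weight k * weight m)) in P; [lra|].
  apply Rmult_le_pos; apply weight_nonneg.
Qed.

Lemma phiser_nonpos mu nu n : 0 <= mu -> 0 <= nu -> phiser f a c mu nu n <= 0.
Proof.
  intros Hmu Hnu. pose proof (fser_wright 0 mu nu n (Rle_refl 0) Hmu Hnu) as W.
  now rewrite !Rplus_0_l in W.
Qed.

Lemma fval_Series mu x :
  fval f a c mu x = Series (fun n => weight n * x ^ n * rratio a c n mu).
Proof.
  apply Series_ext. intros n. apply fser_pow.
Qed.

Section LogConvexity.

Variable x : R.
Hypothesis Hx : conv_interval f a c x.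

Let monomial n := weight n * x ^ n.

Lemma monomial_nonneg n : 0 <= monomial n.
Proof.
  apply Rmult_le_pos; [apply weight_nonneg | left; apply pow_lt, Hx].
Qed.

Lemma ex_series_fval mu : 0 <= mu ->
  ex_series (fun n => monomial n * rratio a c n mu).
Proof.
  intros Hmu. destruct Hx as [_ Hc]. specialize (Hc mu Hmu).
  apply ex_pseries_R in Hc.
  apply (ex_series_ext (fun n => fser f a c mu n * x ^ n)); [|assumption].
  intros n. apply fser_pow.
Qed.

Lemma fval_log_convex : log_convex (fun mu => fval f a c mu x).
Proof.
  split.
  - intros mu Hmu. rewrite fval_Series.
    apply Series_nonneg; [|now apply ex_series_fval].
    intros n. apply Rmult_le_pos; [apply monomial_nonneg | left; now apply rratio_pos].
  - intros mu nu l Hmu Hnu Hl. rewrite !fval_Series.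
    assert (Hm : 0 <= l * mu + (1 - l) * nu)
      by (apply Rplus_le_le_0_compat; apply Rmult_le_pos; lra).
    apply (holder_series l monomial); auto using monomial_nonneg, rratio_pos, ex_series_fval.
    intros n. split; [left; now apply rratio_pos | now apply rratio_log_convex].
Qed.

Lemma fval_strictly_log_convex :
  c < a -> (exists n, (1 <= n)%nat /\ 0 < f n) ->
  strictly_log_convex (fun mu => fval f a c mu x).
Proof.
  intros Hca [n [Hn Hfn]]. split; [apply fval_log_convex|].
  intros mu nu l Hmu Hnu Hne Hl. rewrite !fval_Series.
  assert (Hm : 0 <= l * mu + (1 - l) * nu)
    by (apply Rplus_le_le_0_compat; apply Rmult_le_pos; lra).
  apply (holder_series_strict l monomial) with (n := n);
    auto using monomial_nonneg, rratio_pos, ex_series_fval.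
  - lra.
  - intros k. split; [left; now apply rratio_pos | apply rratio_log_convex; lra].
  - apply Rmult_lt_0_compat; [|apply pow_lt, Hx].
    apply Rdiv_lt_0_compat; [assumption | apply INR_fact_lt_0].
  - apply rratio_log_convex_strict; lra || assumption.
Qed.

End LogConvexity.

Lemma conv_interval_down x y : conv_interval f a c x -> 0 < y <= x ->
  conv_interval f a c y.
Proof.
  intros [Hx Hc] Hy. split; [lra|]. intros mu Hmu. specialize (Hc mu Hmu).
  apply ex_pseries_R in Hc. apply ex_pseries_R.
  apply ex_series_dominated with (fun n => fser f a c mu n * x ^ n); [|assumption].
  intros n. pose proof (fser_nonneg mu n Hmu). split.
  - apply Rmult_le_pos; [assumption | apply pow_le; lra].
  - apply Rmult_le_compat_l; [assumption | apply pow_incr; lra].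
Qed.

(** * The function - phi *)

Section Phi.

Variables mu nu : R.
Hypothesis Hmu : 0 <= mu.
Hypothesis Hnu : 0 <= nu.

Let q n := - phiser f a c mu nu n.

Lemma q_nonneg n : 0 <= q n.
Proof.
  pose proof (phiser_nonpos mu nu n Hmu Hnu). unfold q. lra.
Qed.

(** Mertens' theorem at a point [x > 0] where all terms are nonnegative; it also
    covers an endpoint of the interval of convergence, where the radius of
    convergence gives no information. *)
Lemma is_series_fser_mult s t x : 0 <= s -> 0 <= t -> conv_interval f a c x ->
  is_series (fun n => PS_mult (fser f a c s) (fser f a c t) n * x ^ n)
    (fval f a c s x * fval f a c t x).
Proof.
  intros Hs Ht [Hx Hc].
  assert (E : forall r, 0 <= r ->
            is_series (fun n => fser f a c r n * x ^ n) (fval f a c r x)).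
  { intros r Hr. apply Series_correct, ex_pseries_R, Hc, Hr. }
  assert (P : forall r, 0 <= r -> forall n, 0 <= fser f a c r n * x ^ n).
  { intros r Hr n. apply Rmult_le_pos; [now apply fser_nonneg | apply pow_le; lra]. }
  eapply is_series_ext; [|apply (is_series_mult_pos _ _ _ _ (E s Hs) (E t Ht) (P s Hs) (P t Ht))].
  intros n. unfold PS_mult. rewrite Rmult_comm, scal_sum. apply sum_eq.
  intros k Hk. replace (x ^ n) with (x ^ k * x ^ (n - k)); [ring|].
  rewrite <- pow_add. f_equal. lia.
Qed.

Lemma is_series_q x : conv_interval f a c x ->
  is_series (fun n => q n * x ^ n) (- phival f a c mu nu x).
Proof.
  intros Hx.
  pose proof (is_series_fser_mult mu nu x Hmu Hnu Hx) as S1.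
  pose proof (is_series_fser_mult 0 (mu + nu) x (Rle_refl 0)
                (Rplus_le_le_0_compat _ _ Hmu Hnu) Hx) as S2.
  pose proof (is_series_minus _ _ _ _ S2 S1) as S.
  replace (- phival f a c mu nu x) with
    (plus (fval f a c 0 x * fval f a c (mu + nu) x)
          (opp (fval f a c mu x * fval f a c nu x))).
  - eapply is_series_ext; [|apply S]. intros n.
    unfold q, phiser, PS_minus, plus, opp; simpl. ring.
  - unfold phival, plus, opp; simpl. ring.
Qed.

Lemma phival_PSeries x : conv_interval f a c x ->
  - phival f a c mu nu x = PSeries q x.
Proof. intros Hx. symmetry. now apply is_series_unique, is_series_q. Qed.

Lemma ex_series_q x : conv_interval f a c x -> ex_series (fun n => q n * x ^ n).
Proof. intros Hx. eexists. now apply is_series_q. Qed.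

Lemma opp_phival_nonneg x : conv_interval f a c x -> 0 <= - phival f a c mu nu x.
Proof.
  intros Hx. rewrite phival_PSeries by assumption.
  apply Series_nonneg; [|now apply ex_series_q].
  intros n. apply Rmult_le_pos; [apply q_nonneg | left; apply pow_lt, Hx].
Qed.

(** An interior point is smaller than another point of the interval, so it lies
    strictly inside the disk of convergence. *)
Lemma interior_lt_CV_radius x : locally x (conv_interval f a c) ->
  Rbar_lt (Rabs x) (CV_radius q).
Proof.
  intros HL. destruct (locally_singleton _ _ HL) as [Hx _].
  destruct HL as [e He].
  pose proof (cond_pos e) as Hpos.
  set (y := x + e / 2).
  assert (Hy : conv_interval f a c y).
  { apply He. unfold ball; simpl. unfold AbsRing_ball, abs, minus, plus, opp; simpl.
    unfold y. replace (x + e / 2 + - x) with (e / 2) by ring.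
    rewrite Rabs_pos_eq; lra. }
  apply Rbar_lt_le_trans with (Rabs y).
  - simpl. rewrite !Rabs_pos_eq; unfold y; lra.
  - apply Rbar_not_lt_le. intros Hlt. apply CV_disk_outside in Hlt. apply Hlt.
    apply ex_series_lim_0, ex_series_q, Hy.
Qed.

Lemma opp_phival_absolutely_monotonic :
  absolutely_monotonic_on (conv_interval f a c) (fun x => - phival f a c mu nu x).
Proof.
  split; [exact opp_phival_nonneg|]. intros n x HL.
  pose proof (interior_lt_CV_radius x HL) as Hr.
  assert (E : locally x (fun t => PSeries q t = - phival f a c mu nu t)).
  { apply (filter_imp (conv_interval f a c)); [|assumption].
    intros t Ht. symmetry. now apply phival_PSeries. }
  split.
  - apply (ex_derive_n_ext_loc (PSeries q)); [assumption|].
    now apply ex_derive_n_PSeries.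
  - rewrite <- (Derive_n_ext_loc (PSeries q)) by assumption.
    rewrite Derive_n_PSeries by assumption.
    destruct (locally_singleton _ _ HL) as [Hx _].
    apply Series_nonneg.
    + intros k. apply Rmult_le_pos; [|apply pow_le; lra].
      apply Rmult_le_pos; [|apply q_nonneg].
      left; apply Rdiv_lt_0_compat; apply INR_fact_lt_0.
    + apply ex_pseries_R, CV_radius_inside. now rewrite CV_radius_derive_n.
Qed.

(** Hölder's inequality with the coefficients as weights; the geometric mean of
    two points stays in the interval of convergence because it is at most the
    larger of them. *)
Lemma opp_phival_multiplicatively_convex :
  multiplicatively_convex_on (conv_interval f a c)
    (fun x => - phival f a c mu nu x).
Proof.
  split; [exact opp_phival_nonneg|]. intros x y l Hx Hy Hl.
  destruct (Hx) as [Px _]. destruct (Hy) as [Py _].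
  rewrite (rpow_wgm l x y Px Py).
  assert (Hz : conv_interval f a c (wgm l x y)).
  { pose proof (wgm_pos l x y) as Hz0. pose proof (young l x y Hl Px Py) as Hz1.
    destruct (Rle_dec x y) as [Hxy|Hxy].
    - apply conv_interval_down with y; [assumption|]. split; [assumption|].
      apply (Rmult_le_compat_l l) in Hxy; lra.
    - apply conv_interval_down with x; [assumption|]. split; [assumption|].
      assert (Hyx : y <= x) by lra.
      apply (Rmult_le_compat_l (1 - l)) in Hyx; lra. }
  rewrite !phival_PSeries by assumption. unfold PSeries.
  apply (holder_series l q); auto using q_nonneg, pow_lt, ex_series_q.
  intros n. rewrite wgm_pow by assumption.
  split; [left; apply pow_lt, wgm_pos | apply Rle_refl].
Qed.

End Phi.

End Family.

Theorem theorem2 (a c : R) (f : nat -> R)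
    (hac : a >= c) (hc : c > 0) (hf : forall n, 0 <= f n) :
  (forall x, conv_interval f a c x ->
     log_convex (fun mu => fval f a c mu x)) /\
  (a > c -> (exists n, (1 <= n)%nat /\ 0 < f n) ->
     forall x, conv_interval f a c x ->
       strictly_log_convex (fun mu => fval f a c mu x)) /\
  wright_q_log_convex (fser f a c) /\
  (forall mu nu, 0 <= mu -> 0 <= nu ->
     (forall n, phiser f a c mu nu n <= 0) /\
     absolutely_monotonic_on (conv_interval f a c)
       (fun x => - phival f a c mu nu x) /\
     multiplicatively_convex_on (conv_interval f a c)
       (fun x => - phival f a c mu nu x)).
Proof.
  assert (Hac : 0 < c <= a) by lra.
  split; [|split; [|split]].
  - intros x Hx. now apply fval_log_convex.
  - intros Hca Hex x Hx. now apply fval_strictly_log_convex.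
  - split; [|split].
    + intros n mu Hmu. now apply fser_nonneg.
    + intros n. now apply fser_continuous.
    + intros mu alpha beta Hmu Ha Hb n. now apply fser_wright.
  - intros mu nu Hmu Hnu. split; [|split].
    + intros n. now apply phiser_nonpos.
    + now apply opp_phival_absolutely_monotonic.
    + now apply opp_phival_multiplicatively_convex.
Qed.
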